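(* Let $\tau>0$, $M\ge0$, and let discrete closed curves $\Gamma_h^m=\boldsymbol Y_h^m(\widehat\Gamma_h)$ of degree $\ell\ge1$ be generated from a given $\boldsymbol Y_h^0$ as follows: for each $m=0,\dots,M$, the curve $\Gamma_h^m$ satisfies ($\mathcal A1$): $|\partial_{\widehat{\boldsymbol\tau}}\boldsymbol Y_h^m|>0$ on each $\widehat\sigma_j$, $j=1,\dots,N$; the pair $(\boldsymbol X_h^{m+1},\kappa_h^{m+1})\in[\mathbb V_\ell^m]^2\times\mathbb V_\ell^m$ is a solution of $$\Big(\frac{\boldsymbol X_h^{m+1}-\mathrm{id}}{\tau},\varphi_h\boldsymbol n_h^m\Big)_{\Gamma_h^m}=\begin{cases}(\kappa_h^{m+1},\varphi_h)_{\Gamma_h^m}, & \text{MCF},\\ (\nabla_s\kappa_h^{m+1},\nabla_s\varphi_h)_{\Gamma_h^m}, & \text{SD},\end{cases}\qquad (\kappa_h^{m+1}\boldsymbol n_h^m,\boldsymbol\eta_h)_{\Gamma_h^m}+(\nabla_s\boldsymbol X_h^{m+1},\nabla_s\boldsymbol\eta_h)_{\Gamma_h^m}=0$$ for all $\varphi_h\in\mathbb V_\ell^m$, $\boldsymbol\eta_h\in[\mathbb V_\ell^m]^2$ (with the same choice, MCF or SD, for all $m$); and $\boldsymbol Y_h^{m+1}=\boldsymbol X_h^{m+1}\circ\boldsymbol Y_h^m$. Then $$\mathcal H^1(\Gamma_h^{M+1})\le\mathcal H^1(\Gamma_h^0)-\begin{cases}\tau\sum_{m=0}^M(\kappa_h^{m+1},\kappa_h^{m+1})_{\Gamma_h^m},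 & \text{MCF},\\ \tau\sum_{m=0}^M(\nabla_s\kappa_h^{m+1},\nabla_s\kappa_h^{m+1})_{\Gamma_h^m}, & \text{SD},\end{cases}$$ where $\mathcal H^1(\Gamma_h^m)=\int_{\Gamma_h^m}\mathrm ds=\int_{\widehat\Gamma_h}|\partial_{\widehat{\boldsymbol\tau}}\boldsymbol Y_h^m|\,\mathrm ds$.
   Context: Reference grid. $\widehat{\mathbb K}=[0,1]$; $\widehat\Gamma_h=\bigcup_{j=1}^N\widehat\sigma_j\subset\mathbb R^2$ is a closed polygonal curve with segments $\widehat\sigma_j=A_j(\widehat{\mathbb K})$, $A_j$ injective affine maps; $\widehat{\boldsymbol\tau}$ is the (piecewise constant) unit tangent of the oriented curve $\widehat\Gamma_h$ and $\partial_{\widehat{\boldsymbol\tau}}$ the directional derivative along it. $\mathbb P^\ell$ denotes polynomials of degree $\le\ell$. Discrete curve. $\boldsymbol Y_h^m:\widehat\Gamma_h\to\mathbb R^2$ is continuous with $\boldsymbol Y_h^m|_{\widehat\sigma_j}\in[\mathbb P^\ell(\widehat\sigma_j)]^2$ for each $j$, and $\Gamma_h^m=\boldsymbol Y_h^m(\widehat\Gamma_h)$. Functions on $\Gamma_h^m$ are identified with their pull-backs under $\boldsymbol Y_h^m$ to $\widehat\Gamma_h$. The finite element space is $$\mathbb V_\ell^m=\{v_h\in H^1(\Gamma_h^m): v_h\circ\boldsymbol Y_h^m|_{\widehat\sigma_j}\in\mathbb P^\ell(\widehat\sigma_j),\ j=1,\dots,N\},$$ i.e. the functions whose pull-back $v_h\circ\boldsymbol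 Y_h^m$ is continuous on $\widehat\Gamma_h$ and polynomial of degree $\le\ell$ on each segment. $\mathrm{id}$ is the identity on $\Gamma_h^m$ (pull-back $\boldsymbol Y_h^m$). Geometry. $\boldsymbol n_h^m\circ\boldsymbol Y_h^m=(\partial_{\widehat{\boldsymbol\tau}}\boldsymbol Y_h^m)^\perp/|\partial_{\widehat{\boldsymbol\tau}}\boldsymbol Y_h^m|$ piecewise, where $(\cdot)^\perp$ is rotation by a right angle, of fixed sense (chosen so that $\boldsymbol n_h^m$ is the outer normal). $\boldsymbol\tau^m$ is the unit tangent of $\Gamma_h^m$, and piecewise $\nabla_s f=(\partial_{\boldsymbol\tau^m}f)\,\boldsymbol\tau^m$ (for vector-valued $f$, $\nabla_s f=\partial_{\boldsymbol\tau^m}f\otimes\boldsymbol\tau^m$), where $(\partial_{\boldsymbol\tau^m}f)\circ\boldsymbol Y_h^m=\partial_{\widehat{\boldsymbol\tau}}(f\circ\boldsymbol Y_h^m)/|\partial_{\widehat{\boldsymbol\tau}}\boldsymbol Y_h^m|$. Inner product. $(u,v)_{\Gamma_h^m}=\int_{\widehat\Gamma_h}(u\circ\boldsymbol Y_h^m)\cdot(v\circ\boldsymbol Y_h^m)\,|\partial_{\widehat{\boldsymbol\tau}}\boldsymbol Y_h^m|\,\mathrm ds$ (product, Euclidean or Frobenius inner product for scalars, vectors, matrices). MCF = curvature flow, SD = surface diffusion of curves. *)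

(* Defs.v *)
From HB Require Import structures.
From mathcomp Require Import all_boot all_order all_algebra.
From mathcomp Require Import all_classical all_reals all_analysis.
Set Implicit Arguments.
Unset Strict Implicit.
Unset Printing Implicit Defensive.
Import Order.TTheory GRing.Theory Num.Theory.
Import numFieldNormedType.Exports.
Local Open Scope classical_set_scope.
Local Open Scope ring_scope.

(* The library norm on matrices is the max norm, so the Euclidean (Frobenius)
   structure is introduced here. *)
Definition frob (R : realType) (p q : nat) (u v : 'M[R]_(p, q)) : R :=
  \sum_i \sum_j u i j * v i j.

Definition enorm (R : realType) (p q : nat) (u : 'M[R]_(p, q)) : R :=
  Num.sqrt (frob u u).

(* Rotation by a right angle: counterclockwise for [cw = false], clockwise for
   [cw = true]. Which one yields the outer normal depends on the orientation
   of the curve. *)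
Definition perp (R : realType) (cw : bool) (v : 'rV[R]_2) : 'rV[R]_2 :=
  (-1) ^+ cw *: \row_(i < 2) (if i == ord0 then - v ord0 ord_max else v ord0 ord0).

(* Closed polygonal curve, oriented by the cyclic order of its vertices
   ([ordS] is the cyclic successor). Each affine map parametrizes the segment
   between two consecutive vertices, in either direction. The polygon may
   intersect itself: tangents, derivatives and integrals below are taken
   segment by segment. *)
Record refgrid (R : realType) := RefGrid {
  nseg : nat;
  nseg_gt0 : (0 < nseg)%N;
  vertex : 'I_nseg -> 'rV[R]_2;
  segmap : 'I_nseg -> R -> 'rV[R]_2;
  segmap_affine : forall j, exists a b : 'rV[R]_2,
    forall t, segmap j t = a + t *: b;
  segmap_inj : forall j, injective (segmap j);
  segmap_ends : forall j,
    (segmap j 0 = vertex j /\ segmap j 1 = vertex (ordS j)) \/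
    (segmap j 0 = vertex (ordS j) /\ segmap j 1 = vertex j)
}.

Definition refseg (R : realType) (G : refgrid R) (j : 'I_(nseg G)) :
    set 'rV[R]_2 :=
  [set segmap j t | t in `[0, 1]].

Definition refcurve (R : realType) (G : refgrid R) : set 'rV[R]_2 :=
  \bigcup_(j in [set: 'I_(nseg G)]) refseg j.

Definition reftan (R : realType) (G : refgrid R) (j : 'I_(nseg G)) :
    'rV[R]_2 :=
  (enorm (vertex (ordS j) - vertex j))^-1 *: (vertex (ordS j) - vertex j).

(* A function on the reference curve is a total function on the plane of which
   only the values on [refcurve G] matter. Quantities that are only defined
   piecewise take the index of the segment as an additional argument. *)

(* Derivative of the restriction of [f] to the closed segment [j], in the
   direction of the oriented unit tangent; one-sided at the two end points. *)
Definition dtan (R : realType) (V : normedModType R) (G : refgrid R)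
    (f : 'rV[R]_2 -> V) (j : 'I_(nseg G)) (x : 'rV[R]_2) : V :=
  lim ((fun h : R => h^-1 *: (f (x + h *: reftan j) - f x)) @
       within [set h : R | refseg j (x + h *: reftan j)] 0^').

(* Arc-length integral over the reference curve: the sum of the line integrals
   over the segments, [segmap j] having constant speed. *)
Definition refint (R : realType) (G : refgrid R)
    (f : 'I_(nseg G) -> 'rV[R]_2 -> R) : R :=
  \sum_j enorm (segmap j 1 - segmap j 0) *
    \int[lebesgue_measure]_(t in `[0, 1]) f j (segmap j t).

Definition fe_space (R : realType) (G : refgrid R) (ell : nat)
    (v : 'rV[R]_2 -> R) : Prop :=
  {within refcurve G, continuous v} /\
  forall j : 'I_(nseg G), exists p : {poly R}, (size p <= ell.+1)%N /\
    forall t, t \in `[0, 1] -> v (segmap j t) = p.[t].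

Definition fe_space2 (R : realType) (G : refgrid R) (ell : nat)
    (v : 'rV[R]_2 -> 'rV[R]_2) : Prop :=
  forall i : 'I_2, fe_space G ell (fun x => v x ord0 i).

(* From here on, [Y] parametrizes a curve over [refcurve G], and functions on
   that curve are represented by their pull-backs under [Y]. In particular the
   identity of the curve is represented by [Y], and [fe_space G ell] is the
   finite element space of every such curve. *)

Definition speed (R : realType) (G : refgrid R) (Y : 'rV[R]_2 -> 'rV[R]_2)
    (j : 'I_(nseg G)) (x : 'rV[R]_2) : R :=
  enorm (dtan Y j x).

Definition regular_param (R : realType) (G : refgrid R)
    (Y : 'rV[R]_2 -> 'rV[R]_2) : Prop :=
  forall (j : 'I_(nseg G)) x, refseg j x -> 0 < speed Y j x.

Definition curve_length (R : realType) (G : refgrid R)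
    (Y : 'rV[R]_2 -> 'rV[R]_2) : R :=
  refint (fun (j : 'I_(nseg G)) x => speed Y j x).

Definition utangent (R : realType) (G : refgrid R) (Y : 'rV[R]_2 -> 'rV[R]_2)
    (j : 'I_(nseg G)) (x : 'rV[R]_2) : 'rV[R]_2 :=
  (speed Y j x)^-1 *: dtan Y j x.

Definition unormal (R : realType) (G : refgrid R) (cw : bool)
    (Y : 'rV[R]_2 -> 'rV[R]_2) (j : 'I_(nseg G)) (x : 'rV[R]_2) : 'rV[R]_2 :=
  (speed Y j x)^-1 *: perp cw (dtan Y j x).

Definition dcurve (R : realType) (V : normedModType R) (G : refgrid R)
    (Y : 'rV[R]_2 -> 'rV[R]_2) (f : 'rV[R]_2 -> V)
    (j : 'I_(nseg G)) (x : 'rV[R]_2) : V :=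
  (speed Y j x)^-1 *: dtan f j x.

Definition sgrad (R : realType) (G : refgrid R) (Y : 'rV[R]_2 -> 'rV[R]_2)
    (f : 'rV[R]_2 -> R) (j : 'I_(nseg G)) (x : 'rV[R]_2) : 'rV[R]_2 :=
  (dcurve Y f j x : R) *: utangent Y j x.

(* Vectors are rows, so [a^T *m b] is the tensor product of [a] and [b]. *)
Definition sgrad2 (R : realType) (G : refgrid R) (Y : 'rV[R]_2 -> 'rV[R]_2)
    (f : 'rV[R]_2 -> 'rV[R]_2) (j : 'I_(nseg G)) (x : 'rV[R]_2) : 'M[R]_2 :=
  (dcurve Y f j x)^T *m utangent Y j x.

Definition ip (R : realType) (G : refgrid R) (Y : 'rV[R]_2 -> 'rV[R]_2)
    (u v : 'I_(nseg G) -> 'rV[R]_2 -> R) : R :=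
  refint (fun j x => u j x * v j x * speed Y j x).

Definition ipm (R : realType) (G : refgrid R) (p q : nat)
    (Y : 'rV[R]_2 -> 'rV[R]_2)
    (u v : 'I_(nseg G) -> 'rV[R]_2 -> 'M[R]_(p, q)) : R :=
  refint (fun j x => frob (u j x) (v j x) * speed Y j x).

Inductive flow := MCF | SD.

(* The bilinear form of the flow: mass matrix for curvature flow, stiffness
   matrix for surface diffusion. *)
Definition flow_form (R : realType) (G : refgrid R) (fl : flow)
    (Y : 'rV[R]_2 -> 'rV[R]_2) (u v : 'rV[R]_2 -> R) : R :=
  match fl with
  | MCF => ip Y (fun _ : 'I_(nseg G) => u) (fun _ => v)
  | SD => ipm Y (fun j : 'I_(nseg G) => sgrad Y u j) (sgrad Y v)
  end.

Definition scheme_solution (R : realType) (G : refgrid R) (cw : bool)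
    (ell : nat) (tau : R) (fl : flow) (Y X : 'rV[R]_2 -> 'rV[R]_2)
    (kappa : 'rV[R]_2 -> R) : Prop :=
  [/\ fe_space2 G ell X,
      fe_space G ell kappa,
      forall phi : 'rV[R]_2 -> R, fe_space G ell phi ->
        ipm Y (fun (_ : 'I_(nseg G)) x => tau^-1 *: (X x - Y x))
              (fun j x => phi x *: unormal cw Y j x)
        = flow_form G fl Y kappa phi
    & forall eta : 'rV[R]_2 -> 'rV[R]_2, fe_space2 G ell eta ->
        ipm Y (fun (j : 'I_(nseg G)) x => kappa x *: unormal cw Y j x)
              (fun _ => eta)
        + ipm Y (fun j : 'I_(nseg G) => sgrad2 Y X j) (sgrad2 Y eta) = 0].

(* Main.v *)
Require Import Defs.
From HB Require Import structures.
From mathcomp Require Import all_boot all_order all_algebra.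
From mathcomp Require Import all_classical all_reals all_analysis.
From mathcomp Require Import ring lra.
Import Order.TTheory GRing.Theory Num.Theory.
Import numFieldNormedType.Exports.
Local Open Scope classical_set_scope.
Local Open Scope ring_scope.

(** The scheme is tested with [kappa] in the first equation and with
    [tau^-1 *: (X - Y)] in the second. Since the Frobenius product is symmetric,
    the two coupling terms with the normal coincide and cancel, leaving
      [(grad X, tau^-1 (grad X - grad Y)) = - flow_form kappa kappa],
    where the products are integrated over the curve of [Y]. The integrand on the
    left is [tau^-1 (dX . (dX - dY)) / |dY|] with respect to arc length of the
    reference curve, [d] being the tangential derivative there. The elementary
    inequality [|a| - |b| <= a . (a - b) / |b|] ([enormB_le]) bounds it from
    below by [tau^-1 (|dX| - |dY|)], whose integral is the difference of the
    two lengths. This is the one-step estimate [length_step]; on the reference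
    curve [X] is the next parametrization, so the theorem is the telescoping
    sum of these estimates.

    The analytic content is that this computation is legitimate for derivatives
    defined as limits within a segment and for Lebesgue integrals. Along a
    segment every finite element function is a polynomial in the parameter, so
    its tangential derivative is, up to a constant factor depending on the
    segment only, the formal derivative ([dtan_poly]). Hence the derivative
    depends only on the values on the segment, is linear, and yields
    integrands that are continuous in the parameter, therefore integrable. *)

Set Implicit Arguments.
Unset Strict Implicit.

(** * Frobenius products *)

Lemma frobC (R : realType) (p q : nat) (u v : 'M[R]_(p, q)) :
  frob u v = frob v u.
Proof. by apply: eq_bigr => i _; apply: eq_bigr => k _; rewrite mulrC. Qed.

Lemma frobDr (R : realType) (p q : nat) (u v w : 'M[R]_(p, q)) :
  frob u (v + w) = frob u v + frob u w.
Proof.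
rewrite /frob -big_split; apply: eq_bigr => i _.
by rewrite -big_split; apply: eq_bigr => k _; rewrite mxE mulrDr.
Qed.

Lemma frobZr (R : realType) (p q : nat) (c : R) (u v : 'M[R]_(p, q)) :
  frob u (c *: v) = c * frob u v.
Proof.
rewrite /frob mulr_sumr; apply: eq_bigr => i _.
by rewrite mulr_sumr; apply: eq_bigr => k _; rewrite mxE mulrCA.
Qed.

Lemma frobZl (R : realType) (p q : nat) (c : R) (u v : 'M[R]_(p, q)) :
  frob (c *: u) v = c * frob u v.
Proof. by rewrite frobC frobZr frobC. Qed.

Lemma frobBr (R : realType) (p q : nat) (u v w : 'M[R]_(p, q)) :
  frob u (v - w) = frob u v - frob u w.
Proof. by rewrite frobDr -scaleN1r frobZr mulN1r. Qed.

Lemma frob_ge0 (R : realType) (p q : nat) (u : 'M[R]_(p, q)) : 0 <= frob u u.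
Proof. by apply: sumr_ge0 => i _; apply: sumr_ge0 => k _; rewrite -expr2 sqr_ge0. Qed.

Lemma enorm_sqr (R : realType) (p q : nat) (u : 'M[R]_(p, q)) :
  enorm u ^+ 2 = frob u u.
Proof. by rewrite sqr_sqrtr// frob_ge0. Qed.

Lemma frob_tensor (R : realType) (n : nat) (a b t : 'rV[R]_n) :
  frob (a^T *m t) (b^T *m t) = frob a b * frob t t.
Proof.
rewrite /frob !big_ord1 mulr_suml; apply: eq_bigr => i _.
rewrite mulr_sumr; apply: eq_bigr => k _.
by rewrite !mxE !big_ord1 !mxE; ring.
Qed.

(** Multiplied by [|b|], the claim follows from [2 a.b <= |a|^2 + |b|^2] and
    [2 |a| |b| <= |a|^2 + |b|^2], so that the Cauchy-Schwarz inequality is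
    avoided. *)
Lemma enormB_le (R : realType) (p q : nat) (a b : 'M[R]_(p, q)) :
  0 < enorm b -> enorm a - enorm b <= frob a (a - b) / enorm b.
Proof.
move=> b0; rewrite ler_pdivlMr// frobBr.
have := frob_ge0 (a - b).
rewrite frobBr (frobC _ a) (frobC _ b) !frobBr (frobC b a) -!enorm_sqr.
by have := sqr_ge0 (enorm a - enorm b); nra.
Qed.

(** * Tangential derivatives along a segment *)

(** Moving along the unit tangent is an affine change of the parameter; [c] is
    the inverse length of the segment, with a sign that compares the direction
    of [segmap j] with the orientation of the curve. *)
Lemma reftan_shift (R : realType) (G : refgrid R) (j : 'I_(nseg G)) :
  exists2 c : R, c != 0 &
    forall t h, segmap j t + h *: reftan j = segmap j (t + h * c).
Proof.
have [a [b sE]] := segmap_affine j.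
have b0 : b != 0.
  apply/eqP => b0; have /segmap_inj/eqP : segmap j 0 = segmap j 1.
    by rewrite !sE b0 !scaler0.
  by rewrite eq_sym oner_eq0.
have e0 : enorm b != 0.
  apply/eqP => eb; move/eqP: b0; apply; apply/matrixP => i k.
  have := enorm_sqr b; rewrite eb expr0n/= => /esym/eqP.
  rewrite psumr_eq0 => [/allP/(_ i)|i' _]; last first.
    by apply: sumr_ge0 => k' _; rewrite -expr2 sqr_ge0.
  rewrite mem_index_enum => /(_ isT)/=.
  rewrite psumr_eq0 => [/allP/(_ k)|k' _]; last by rewrite -expr2 sqr_ge0.
  by rewrite mem_index_enum => /(_ isT)/=; rewrite mulf_eq0 orbb mxE => /eqP.
have eN : enorm (- b) = enorm b.
  by rewrite /enorm -scaleN1r frobZr frobZl !mulN1r opprK.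
have [[v0 v1]|[v1 v0]] := segmap_ends j.
- exists (enorm b)^-1; first by rewrite invr_eq0.
  move=> t h; rewrite /reftan -v0 -v1 !sE scale0r scale1r addr0.
  by rewrite [a + b]addrC addrK scalerDl scalerA addrA.
- exists (- (enorm b)^-1); first by rewrite oppr_eq0 invr_eq0.
  move=> t h; rewrite /reftan -v0 -v1 !sE scale0r scale1r addr0 opprD addrA subrr add0r.
  by rewrite eN scalerDl !scalerN mulrN scaleNr scalerA addrA.
Qed.

Definition poly_on (R : realType) (G : refgrid R) (n : nat) (j : 'I_(nseg G))
    (f : 'rV[R]_2 -> 'rV[R]_n) (p : 'I_n -> {poly R}) : Prop :=
  forall t, t \in `[0, 1] -> forall i, f (segmap j t) 0 i = (p i).[t].

(** The difference quotient of a polynomial is again a polynomial in the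
    increment, so that the derivative is obtained by continuity at [0], also for
    one-sided limits. *)
Lemma poly_diff_quotient (R : realType) (p : {poly R}) (t : R) :
  exists q : {poly R}, q.[0] = p^`().[t] /\
    forall u, p.[t + u] - p.[t] = u * q.[u].
Proof.
elim/poly_ind: p => [|p a [q [q0 qE]]].
  by exists 0; rewrite deriv0 !horner0; split=> // u; rewrite !horner0 mulr0 subrr.
exists (p \Po ('X + t%:P) + t *: q); split.
  by rewrite derivD derivC addr0 derivM derivX !hornerE horner_comp !hornerE q0; ring.
move=> u; rewrite !hornerE horner_comp !hornerE (addrC u t).
by have /(congr1 (fun z => z + p.[t])) := qE u; rewrite subrK => ->; ring.
Qed.

(** A limit along a filter is unique only if the filter is proper: arbitrarily
    small non-zero increments have to keep the parameter inside [[0, 1]]. *)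
Lemma within_seg_proper (R : realType) (c t : R) : c != 0 -> t \in `[0, 1] ->
  ProperFilter (within [set h : R | t + h * c \in `[0, 1]] 0^').
Proof.
move=> c0 t01; apply: Build_ProperFilter_ex => P.
rewrite /within/= => /nbhs_ballP[e /= e0 eP].
move: t01; rewrite in_itv/= => /andP[t0 t1].
(* The increment moves the parameter by at most 1/2, towards the farther end
   of the interval. *)
pose d := Num.min (e / 2) (`|c|^-1 / 2).
have ic : 0 < `|c|^-1 by rewrite invr_gt0 normr_gt0.
have d0 : 0 < d by rewrite lt_min !divr_gt0.
have dc : d * `|c| <= 2^-1.
  rewrite -ler_pdivlMr ?normr_gt0// mulrC.
  by rewrite ge_min lexx orbT.
pose s : R := if t <= 2^-1 then 1 else -1.
have s1 : `|s| = 1 by rewrite /s; case: ifP; rewrite ?normrN normr1.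
have [sc cs] : (Num.sg c * c = `|c|) /\ `|Num.sg c| = 1.
  by rewrite -normrEsg normr_sg c0.
exists (s * Num.sg c * d); apply: eP.
- rewrite /ball/= sub0r normrN !normrM s1 cs !mul1r gtr0_norm//.
  by rewrite gt_min; apply/orP; left; rewrite ltr_pdivrMr// mulr_natr mulr2n ltrDl.
- by rewrite -normr_gt0 !normrM s1 cs !mul1r gtr0_norm.
- have -> : s * Num.sg c * d * c = s * (d * `|c|) by rewrite -sc; ring.
  have dc0 : 0 <= d * `|c| by rewrite mulr_ge0// ltW.
  rewrite in_itv/= /s; case: (leP t) => ht; lra.
Qed.

(** The constant is quantified before the function: this is what makes the
    tangential derivative on a segment linear and local. *)
Lemma dtan_poly (R : realType) (G : refgrid R) (j : 'I_(nseg G)) :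
  exists c : R, forall n (f : 'rV[R]_2 -> 'rV[R]_n.+1) p, poly_on j f p ->
    forall t, t \in `[0, 1] ->
      dtan f j (segmap j t) = c *: \row_i (p i)^`().[t].
Proof.
have [c c0 cE] := reftan_shift j.
exists c => n f p fp t t01.
have segE : [set h : R | refseg j (segmap j t + h *: reftan j)] =
            [set h : R | t + h * c \in `[0, 1]].
  apply/seteqP; split => h /=; rewrite cE.
    by move=> [s s01 /segmap_inj <-].
  by move=> th; exists (t + h * c).
rewrite /dtan segE.
have PF := within_seg_proper c0 t01.
have [q qE] : exists q : 'I_n.+1 -> {poly R}, forall i, (q i).[0] = (p i)^`().[t] /\
    forall u, (p i).[t + u] - (p i).[t] = u * (q i).[u].
  exact: fin_all_exists (fun i => poly_diff_quotient (p i) t).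
(* The limit is computed entry by entry, the row being a linear combination of
   the basis rows. *)
rewrite [RHS]row_sum_delta; apply: cvg_lim => //.
pose g h : 'rV[R]_n.+1 := \sum_i (c * (q i).[h * c]) *: delta_mx 0 i.
apply: (cvg_trans (G := g @ within [set h : R | t + h * c \in `[0, 1]] 0^')).
  apply: near_eq_cvg; rewrite /= near_withinE /g.
  near=> h => th.
  rewrite [RHS]row_sum_delta; apply: eq_bigr => i _; congr (_ *: _).
  rewrite !mxE cE !fp// (proj2 (qE i)).
  rewrite -mulrA mulKf; last by near: h; exact: nbhs_dnbhs_neq.
  by [].
apply: cvg_within_filter; apply: cvg_within_filter.
apply: (cvg_big (@add_continuous _)) => i _; apply: cvgZr_tmp.
rewrite !mxE -(proj1 (qE i)); apply: cvgMl_tmp.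
have : {for (0 : R), continuous (fun h : R => (q i).[h * c])}.
  apply: continuous_comp; last exact: continuous_horner.
  exact: mulrr_continuous.
by rewrite /prop_for/continuous_at/= mul0r.
Unshelve. all: by end_near.
Qed.

Lemma dtan_eq (R : realType) (G : refgrid R) (j : 'I_(nseg G)) (n : nat)
    (f g : 'rV[R]_2 -> 'rV[R]_n.+1) p x :
  poly_on j f p -> poly_on j g p -> refseg j x -> dtan f j x = dtan g j x.
Proof.
move=> fp gp [t t01 <-]; have [c cE] := dtan_poly j.
by rewrite (cE _ _ _ fp) ?(cE _ _ _ gp).
Qed.

Lemma dtan_scaleB (R : realType) (G : refgrid R) (j : 'I_(nseg G)) (n : nat)
    (a : R) (f g : 'rV[R]_2 -> 'rV[R]_n.+1) p q x :
  poly_on j f p -> poly_on j g q -> refseg j x ->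
  dtan (fun y => a *: (f y - g y)) j x = a *: (dtan f j x - dtan g j x).
Proof.
move=> fp gq [t t01 <-]; have [c cE] := dtan_poly j.
have hp : poly_on j (fun y => a *: (f y - g y)) (fun i => a *: (p i - q i)).
  by move=> s s01 i; rewrite !mxE fp// gq// !hornerE.
rewrite (cE _ _ _ hp)// (cE _ _ _ fp)// (cE _ _ _ gq)//.
apply/rowP => i; rewrite !mxE derivZ derivB hornerZ hornerD hornerN.
by rewrite -mulrBr; exact: mulrCA.
Qed.

Lemma frob_dtan_continuous (R : realType) (G : refgrid R) (j : 'I_(nseg G))
    (n : nat) (f g : 'rV[R]_2 -> 'rV[R]_n.+1) p q :
  poly_on j f p -> poly_on j g q ->
  {within `[0, 1], continuous
    (fun t : R => frob (dtan f j (segmap j t)) (dtan g j (segmap j t)))}.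
Proof.
move=> fp gq; have [c cE] := dtan_poly j.
pose P := (c ^+ 2) *: \sum_i (p i)^`() * (q i)^`().
apply: (@subspace_eq_continuous _ _ _ (horner P)); last first.
  by apply: continuous_subspaceT; exact: continuous_horner.
move=> t; rewrite inE /from_subspace => t01; symmetry.
rewrite (cE _ _ _ fp)// (cE _ _ _ gq)// frobZl frobZr /frob big_ord1.
rewrite /P hornerZ horner_sum expr2 -mulrA; congr (_ * (_ * _)).
by apply: eq_bigr => i _; rewrite !mxE hornerM.
Qed.

Lemma speed_continuous (R : realType) (G : refgrid R) (j : 'I_(nseg G))
    (f : 'rV[R]_2 -> 'rV[R]_2) p :
  poly_on j f p ->
  {within `[0, 1], continuous (fun t : R => speed f j (segmap j t))}.
Proof.
move=> fp; have := frob_dtan_continuous fp fp.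
rewrite !subspace_continuousP => cf t t01.
exact: (continuous_cvg _ (@sqrt_continuous R _) (cf t t01)).
Qed.

(** * Integrals over the reference curve *)

Lemma refintZB (R : realType) (G : refgrid R) (a : R)
    (f g : 'I_(nseg G) -> 'rV[R]_2 -> R) :
  (forall j, {within `[0, 1], continuous (fun t : R => f j (segmap j t))}) ->
  (forall j, {within `[0, 1], continuous (fun t : R => g j (segmap j t))}) ->
  refint (fun j x => a * (f j x - g j x)) = a * (refint f - refint g).
Proof.
move=> cf cg.
have int (h : R -> R) : {within `[0, 1], continuous h} ->
    lebesgue_measure.-integrable `[0, 1] (EFin \o h).
  by apply: continuous_compact_integrable; exact: segment_compact.
rewrite /refint -sumrB mulr_sumr; apply: eq_bigr => j _.
rewrite RintegralZl ?RintegralB//; first ring.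
- exact: int.
- exact: int.
- by apply: int => x; apply: cvgB; [exact: cf|exact: cg].
Qed.

Lemma le_refint (R : realType) (G : refgrid R)
    (f g : 'I_(nseg G) -> 'rV[R]_2 -> R) :
  (forall j, {within `[0, 1], continuous (fun t : R => f j (segmap j t))}) ->
  (forall j, {within `[0, 1], continuous (fun t : R => g j (segmap j t))}) ->
  (forall j x, refseg j x -> f j x <= g j x) -> refint f <= refint g.
Proof.
move=> cf cg fg; apply: ler_sum => j _; apply: ler_wpM2l; first exact: sqrtr_ge0.
apply: le_Rintegral => //.
- by apply: continuous_compact_integrable (cf j); exact: segment_compact.
- by apply: continuous_compact_integrable (cg j); exact: segment_compact.
- by move=> t t01; apply: fg; exists t.
Qed.

Lemma eq_refint (R : realType) (G : refgrid R)
    (f g : 'I_(nseg G) -> 'rV[R]_2 -> R) :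
  (forall j x, refseg j x -> f j x = g j x) -> refint f = refint g.
Proof.
move=> fg; apply: eq_bigr => j _; congr (_ * _).
by apply: eq_Rintegral => t; rewrite inE => t01; apply: fg; exists t.
Qed.

(** * Finite element functions *)

Lemma fe_space2_poly (R : realType) (G : refgrid R) (ell : nat)
    (f : 'rV[R]_2 -> 'rV[R]_2) (j : 'I_(nseg G)) :
  fe_space2 G ell f -> exists p, poly_on j f p.
Proof.
move=> ff.
have [p pE] : exists p : 'I_2 -> {poly R}, forall i, forall t, t \in `[0, 1] ->
    f (segmap j t) 0 i = (p i).[t].
  apply: (@fin_all_exists _ _
    (fun i (p : {poly R}) => forall t, t \in `[0, 1] ->
      f (segmap j t) 0 i = p.[t])) => i.
  by have [_ /(_ j)[p [_ pE]]] := ff i; exists p.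
by exists p => t t01 i; exact: pE.
Qed.

Lemma fe_space2_eq (R : realType) (G : refgrid R) (ell : nat)
    (f g : 'rV[R]_2 -> 'rV[R]_2) :
  (forall x, refcurve G x -> g x = f x) ->
  fe_space2 G ell f -> fe_space2 G ell g.
Proof.
move=> gf ff i; have [cf pf] := ff i; split.
  apply: (subspace_eq_continuous _ cf) => x; rewrite inE => Gx.
  by rewrite /from_subspace gf.
move=> j; have [p [sp pE]] := pf j; exists p; split=> // t t01.
by rewrite gf ?pE//; exists j => //; exists t.
Qed.

Lemma fe_space2_scaleB (R : realType) (G : refgrid R) (ell : nat) (a : R)
    (f g : 'rV[R]_2 -> 'rV[R]_2) :
  fe_space2 G ell f -> fe_space2 G ell g ->
  fe_space2 G ell (fun x => a *: (f x - g x)).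
Proof.
move=> ff fg i; have [cf pf] := ff i; have [cg pg] := fg i.
have -> : (fun x => (a *: (f x - g x)) ord0 i) =
          (fun x => a * (f x ord0 i - g x ord0 i)).
  by apply/funext => x; rewrite !mxE.
split.
  by move=> x; apply: cvgM; [exact: cvg_cst|apply: cvgB; [exact: cf|exact: cg]].
move=> j; have [p [sp pE]] := pf j; have [q [sq qE]] := pg j.
exists (a *: (p - q)); split.
  apply: leq_trans (size_scale_leq _ _) _.
  by apply: leq_trans (size_polyD _ _) _; rewrite size_polyN geq_max sp.
by move=> t t01; rewrite pE// qE// !hornerE.
Qed.

(** * Decay of the length *)

(** Testing the second equation with [tau^-1 *: (X - Y)] rather than [X - Y]
    makes its coupling term that of the first equation with the factors
    exchanged, so that no linearity, hence no integrability, is needed for the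
    integrals containing the normal and [kappa]. *)
Lemma length_step (R : realType) (G : refgrid R) (cw : bool) (ell : nat)
    (tau : R) (fl : flow) (Y X : 'rV[R]_2 -> 'rV[R]_2)
    (kappa : 'rV[R]_2 -> R) :
  0 < tau -> fe_space2 G ell Y -> regular_param G Y ->
  scheme_solution G cw ell tau fl Y X kappa ->
  curve_length G X <= curve_length G Y - tau * flow_form G fl Y kappa kappa.
Proof.
move=> tau0 fY regY [fX fk eqk eqX].
pose Z x := tau^-1 *: (X x - Y x).
have fZ : fe_space2 G ell Z by exact: fe_space2_scaleB.
have energy : ipm Y (fun j : 'I_(nseg G) => sgrad2 Y X j) (sgrad2 Y Z) =
    - flow_form G fl Y kappa kappa.
  apply/eqP; rewrite -addr_eq0 addrC -[X in _ == X](eqX _ fZ) -(eqk _ fk).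
  by apply/eqP; congr (_ + _); apply: eq_refint => j x _; rewrite frobC.
have cspeed W : fe_space2 G ell W -> forall j : 'I_(nseg G),
    {within `[0, 1], continuous (fun t : R => speed W j (segmap j t))}.
  by move=> fW j; have [p Wp] := fe_space2_poly j fW; exact: speed_continuous Wp.
have gradE (j : 'I_(nseg G)) x : refseg j x ->
    frob (sgrad2 Y X j x) (sgrad2 Y Z j x) * speed Y j x =
    frob (dtan X j x) (dtan Z j x) / speed Y j x.
  move=> jx; have s0 : speed Y j x != 0 by rewrite gt_eqF// regY.
  rewrite /sgrad2 /dcurve /utangent frob_tensor !frobZl !frobZr.
  rewrite -(enorm_sqr (dtan Y j x)) -/(speed Y j x).
  by field.
suff : tau^-1 * (curve_length G X - curve_length G Y)
    <= - flow_form G fl Y kappa kappa.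
  by rewrite ler_pdivrMl// mulrN lerBlDr addrC.
rewrite -energy /curve_length -refintZB; try exact: cspeed.
rewrite /ipm (eq_refint gradE).
apply: le_refint.
- move=> j x; apply: cvgM; first exact: cvg_cst.
  by apply: cvgB; [exact: (cspeed _ fX)|exact: (cspeed _ fY)].
- move=> j.
  have [p Xp] := fe_space2_poly j fX; have [q Zq] := fe_space2_poly j fZ.
  have := frob_dtan_continuous Xp Zq.
  have := cspeed _ fY j.
  rewrite !subspace_continuousP => cY cXZ t t01.
  apply: cvgM; first exact: cXZ.
  apply: cvgV; last exact: cY.
  by rewrite gt_eqF// regY//; exists t.
- move=> j x jx.
  have [p Xp] := fe_space2_poly j fX; have [q Yq] := fe_space2_poly j fY.
  rewrite (dtan_scaleB tau^-1 Xp Yq jx) frobZr -mulrA.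
  rewrite ler_pM2l ?invr_gt0//.
  exact: enormB_le (regY _ _ jx).
Qed.

Unset Implicit Arguments.
Set Strict Implicit.

Theorem theorem2p3 (R : realType) (G : refgrid R) (cw : bool) (ell : nat)
    (tau : R) (M : nat) (fl : flow)
    (Y X : nat -> 'rV[R]_2 -> 'rV[R]_2) (kappa : nat -> 'rV[R]_2 -> R)
    (ell_ge1 : (1 <= ell)%N) (tau_gt0 : 0 < tau)
    (Y0_fe : fe_space2 G ell (Y 0%N))
    (Y_nondeg : forall m, (m <= M)%N -> regular_param G (Y m))
    (XK_sol : forall m, (m <= M)%N ->
       scheme_solution G cw ell tau fl (Y m) (X m.+1) (kappa m.+1))
    (Y_next : forall m, (m <= M)%N -> forall x, refcurve G x ->
       Y m.+1 x = X m.+1 x) :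
  curve_length G (Y M.+1) <=
    curve_length G (Y 0%N)
    - tau * \sum_(0 <= m < M.+1)
        flow_form G fl (Y m) (kappa m.+1) (kappa m.+1).
Proof.
have feY m : (m <= M)%N -> fe_space2 G ell (Y m).
  case: m => [//|m mM].
  have [fX _ _ _] := XK_sol _ (ltnW mM).
  exact: fe_space2_eq (Y_next _ (ltnW mM)) fX.
have step m : (m <= M)%N -> tau * flow_form G fl (Y m) (kappa m.+1) (kappa m.+1)
    <= curve_length G (Y m) - curve_length G (Y m.+1).
  move=> mM; have [fX _ _ _] := XK_sol _ mM.
  have -> : curve_length G (Y m.+1) = curve_length G (X m.+1).
    apply: eq_refint => j x jx; have [p Xp] := fe_space2_poly j fX.
    rewrite /speed (dtan_eq (g := X m.+1) (p := p))// => t t01 i.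
    by rewrite Y_next// ?Xp//; exists j => //; exists t.
  rewrite lerBrDl addrC -lerBrDl.
  exact: length_step tau_gt0 (feY _ mM) (Y_nondeg _ mM) (XK_sol _ mM).
have tele := telescope_sumr (fun m => curve_length G (Y m)) (leq0n M.+1).
suff : tau * \sum_(0 <= m < M.+1) flow_form G fl (Y m) (kappa m.+1) (kappa m.+1)
    <= - \sum_(0 <= m < M.+1) (curve_length G (Y m.+1) - curve_length G (Y m)).
  by rewrite tele opprB !lerBrDl addrC.
rewrite mulr_sumr -sumrN; apply: ler_sum_nat => m /andP[_ mM].
by rewrite opprB step.
Qed.
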